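(* Let $\mathcal H:=\mathcal H_0\oplus\mathcal H_1$ and let $(\mathcal H,\mathcal G,\gamma_0)$ be a first order boundary triple for the exterior derivative $d$. Write $$D:=\begin{pmatrix}0&\delta\\ d&0\end{pmatrix},\qquad\operatorname{dom}D:=\mathcal H^1:=\mathcal H_0^1\oplus\mathcal H_1^1,\qquad\|f\|_{\mathcal H^1}^2=\|f\|_{\mathcal H}^2+\|Df\|_{\mathcal H}^2,$$ and $\Gamma_pf:=\gamma_pf_p$ ($p=0,1$) for $f=f_0\oplus f_1\in\mathcal H^1$. Then $(\mathcal G^{1/2},\Gamma_0,\Gamma_1)$ is an ordinary boundary triple for $D$.
   Context: Inner products are antilinear in the first and linear in the second argument. A first order boundary triple consists of Hilbert spaces $\mathcal H_0,\mathcal H_1,\mathcal G$, a closed linear operator $d$ from $\mathcal H_0$ to $\mathcal H_1$ (the exterior derivative) with dense domain $\mathcal H_0^1:=\operatorname{dom} d\subset\mathcal H_0$, normed by $\|f_0\|_{\mathcal H_0^1}^2=\|f_0\|^2+\|df_0\|^2$, and a bounded operator $\gamma_0:\mathcal H_0^1\to\mathcal G$ (boundary map) with dense range $\mathcal G^{1/2}:=\gamma_0(\mathcal H_0^1)\subset\mathcal G$ such that $\mathring{\mathcal H}_0^1:=\ker\gamma_0$ is dense in $\mathcal H_0$. Put $d_0:=d\restriction_{\mathring{\mathcal H}_0^1}$, $\delta:=d_0^*$ (the divergence operator, from $\mathcal H_1$ to $\mathcal H_0$), $\mathcal H_1^1:=\operatorname{dom}\delta$ with $\|f_1\|_{\mathcal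 H_1^1}^2=\|f_1\|^2+\|\delta f_1\|^2$. Let $\mathcal N_0:=\ker(\delta d+1)\subset\{f_0\in\operatorname{dom}d\mid df_0\in\operatorname{dom}\delta\}$ and $\mathcal N_1:=\ker(d\delta+1)\subset\{f_1\in\operatorname{dom}\delta\mid\delta f_1\in\operatorname{dom}d\}$, regarded as subspaces of $\mathcal H_0^1$, $\mathcal H_1^1$. The restriction $\hat\gamma_0:=\gamma_0\restriction_{\mathcal N_0}$ is a bijection onto $\mathcal G^{1/2}$, and $\mathcal G^{1/2}$ carries the Hilbert norm $\|\varphi\|_{\mathcal G^{1/2}}:=\|(\hat\gamma_0)^{-1}\varphi\|_{\mathcal H_0^1}$. The boundary map of order $1$ is $\gamma_1:=-\gamma_0\,\delta P_1:\mathcal H_1^1\to\mathcal G$, where $P_1$ is the orthogonal projection in $\mathcal H_1^1$ onto $\mathcal N_1$; it has range $\mathcal G^{1/2}$. Ordinary boundary triple: given a Hilbert space $\mathcal H$, a closed operator $D$ in $\mathcal H$, a Hilbert space $\widetilde{\mathcal G}$ and linear maps $\Gamma_0,\Gamma_1:\operatorname{dom}D\to\widetilde{\mathcal G}$, one says that $(\widetilde{\mathcal G},\Gamma_0,\Gamma_1)$ is an (ordinary) boundary triple for $D$ iff (a) $\langle Df,g\rangle_{\mathcal H}-\langle f,Dg\rangle_{\mathcal H}=\langle\Gamma_0f,\Gamma_1g\rangle_{\widetilde{\mathcal G}}-\langle\Gamma_1f,\Gamma_0g\rangle_{\widetilde{\mathcal G}}$ for all $f,g\in\operatorname{dom}D$;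 (b) the map $\operatorname{dom}D\to\widetilde{\mathcal G}\oplus\widetilde{\mathcal G}$, $f\mapsto\Gamma_0f\oplus\Gamma_1f$, is surjective; (c) $\ker\Gamma_0\cap\ker\Gamma_1$ is dense in $\mathcal H$. *)

(* Defs.v *)
From HB Require Import structures.
From mathcomp Require Import all_boot all_order all_algebra.
From mathcomp Require Import complex.
From mathcomp Require Import ring lra.
From mathcomp Require Import all_classical all_reals topology normedtype.

Set Implicit Arguments.
Unset Strict Implicit.
Unset Printing Implicit Defensive.

Import Order.TTheory GRing.Theory Num.Theory.
Import numFieldNormedType.Exports.

Local Open Scope classical_set_scope.
Local Open Scope ring_scope.

(* Complex Hilbert spaces. The inner product is antilinear in its first and
   linear in its second argument. *)
HB.mixin Record NormedModule_isHilbert (R : realType) H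
    & CompleteNormedModule R[i] H := {
  inner : H -> H -> R[i];
  innerP : forall (x : H) (a : R[i]) (y z : H),
    inner x (a *: y + z) = a * inner x y + inner x z;
  inner_conj : forall x y : H, inner y x = (inner x y)^* ;
  inner_norm : forall x : H, inner x x = `|x| ^+ 2
}.

#[short(type="hilbertType")]
HB.structure Definition Hilbert (R : realType) :=
  {H of CompleteNormedModule R[i] H & NormedModule_isHilbert R H}.

HB.factory Record Lmodule_isHilbert (R : realType) H & GRing.Lmodule R[i] H := {
  ip : H -> H -> R[i];
  ipP : forall (x : H) (a : R[i]) (y z : H),
    ip x (a *: y + z) = a * ip x y + ip x z;
  ip_conj : forall x y : H, ip y x = (ip x y)^* ;
  ip_ge0 : forall x : H, 0 <= ip x x;
  ip_eq0 : forall x : H, ip x x = 0 -> x = 0;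
  ip_complete : forall F : set_system H, ProperFilter F ->
    (forall e, 0 < e -> exists x, F [set y | ip (x - y) (x - y) < e]) ->
    exists l, forall e, 0 < e -> F [set y | ip (l - y) (l - y) < e]
}.

HB.builders Context R H & Lmodule_isHilbert R H.

Lemma ipDr x y z : ip x (y + z) = ip x y + ip x z.
Proof. by have := ipP x 1 y z; rewrite scale1r mul1r. Qed.

Lemma ip0r x : ip x 0 = 0.
Proof. by apply: (addrI (ip x 0)); rewrite -ipDr !addr0. Qed.

Lemma ipZr x a y : ip x (a *: y) = a * ip x y.
Proof. by rewrite -[a *: y]addr0 ipP ip0r addr0. Qed.

Lemma ipDl x y z : ip (x + y) z = ip x z + ip y z.
Proof. by rewrite ip_conj ipDr rmorphD /= -!ip_conj. Qed.

Lemma ipZl x a y : ip (a *: x) y = a^* * ip x y.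
Proof. by rewrite ip_conj ipZr rmorphM /= -ip_conj. Qed.

Lemma ip0l x : ip 0 x = 0.
Proof. by rewrite ip_conj ip0r rmorph0. Qed.

Lemma ip_CS x y : `|ip x y| ^+ 2 <= ip x x * ip y y.
Proof.
have [y0|yn0] := eqVneq (ip y y) 0.
  by rewrite (ip_eq0 y0) !ip0r normr0 expr0n mulr0.
have yy0 : 0 < ip y y by rewrite lt_def yn0 ip_ge0.
pose a := ip y x / ip y y; pose u := x + (- a) *: y.
have yu : ip y u = 0 by rewrite /u ipDr ipZr mulNr divfK ?subrr.
have uE : ip u u = ip x x - `|ip x y| ^+ 2 / ip y y.
  rewrite {1}/u ipDl ipZl yu mulr0 addr0 /u ipDr ipZr; congr (_ + _).
  by rewrite mulNr normCK -(ip_conj x y) [ip x y * _]mulrC mulrAC.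
by have := ip_ge0 u; rewrite uE subr_ge0 ler_pdivrMr.
Qed.

Let norm (x : H) : R[i] := sqrtC (ip x x).

Let norm_ge0 x : 0 <= norm x. Proof. by rewrite sqrtC_ge0 ip_ge0. Qed.

Let norm_sqr x : norm x ^+ 2 = ip x x. Proof. exact: sqrtCK. Qed.

Let normD x y : norm (x + y) <= norm x + norm y.
Proof.
rewrite -ler_sqr ?nnegrE ?addr_ge0// sqrrD !norm_sqr ipDl !ipDr.
rewrite -!addrA lerD2l !addrA lerD2r (ip_conj x y).
have xyE : ip x y + (ip x y)^* = 'Re (ip x y) *+ 2.
  by rewrite -mulr_natr ReE divfK// pnatr_eq0.
rewrite xyE lerMn2r/=; apply: (le_trans (leif_Re_Creal _)).
by rewrite -ler_sqr ?nnegrE ?mulr_ge0// exprMn !norm_sqr ip_CS.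
Qed.

Let normZ (a : R[i]) x : norm (a *: x) = `|a| * norm x.
Proof.
apply: (@pexpIrn _ 2); rewrite ?nnegrE ?mulr_ge0//.
by rewrite exprMn !norm_sqr ipZl ipZr mulrA normCKC.
Qed.

Let norm0_eq0 x : norm x = 0 -> x = 0.
Proof. by move=> x0; apply: ip_eq0; rewrite -norm_sqr x0 expr0n. Qed.

HB.instance Definition _ := Lmodule_isNormed.Build R[i] H normD normZ norm0_eq0.

Let normE (x : H) : `|x| = norm x. Proof. by []. Qed.

Let ip_lt x e : 0 < e -> (ip x x < e ^+ 2) = (`|x| < e).
Proof. by move=> e0; rewrite normE -norm_sqr ltr_sqr ?nnegrE// ltW. Qed.

Let complete (F : set_system H) : ProperFilter F -> cauchy F -> cvg F.
Proof.
move=> FF /cauchyP Fc.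
have [e e0|l Fl] := @ip_complete F FF.
  have s0 : 0 < sqrtC e by rewrite sqrtC_gt0.
  have [x Fx] := Fc _ s0; exists x; apply: filterS Fx => y.
  by rewrite -ball_normE /= -ip_lt// sqrtCK.
apply/cvg_ex; exists l; apply/cvgrPdist_lt => e e0.
have e20 : 0 < e ^+ 2 by rewrite exprn_gt0.
by apply: filterS (Fl _ e20) => y /=; rewrite ip_lt.
Qed.

HB.instance Definition _ := Uniform_isComplete.Build H complete.

Let ip_norm x : ip x x = `|x| ^+ 2. Proof. by rewrite normE norm_sqr. Qed.

HB.instance Definition _ := NormedModule_isHilbert.Build R H ipP ip_conj ip_norm.

HB.end.

Section InnerTheory.
Variables (R : realType) (H : hilbertType R).
Implicit Types (x y z : H) (a : R[i]).

Lemma innerDr x y z : inner x (y + z) = inner x y + inner x z.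
Proof. by have := innerP x 1 y z; rewrite scale1r mul1r. Qed.

Lemma inner0r x : inner x 0 = 0.
Proof. by apply: (addrI (inner x 0)); rewrite -innerDr !addr0. Qed.

Lemma innerZr x a y : inner x (a *: y) = a * inner x y.
Proof. by rewrite -[a *: y]addr0 innerP inner0r addr0. Qed.

Lemma innerNr x y : inner x (- y) = - inner x y.
Proof. by rewrite -scaleN1r innerZr mulN1r. Qed.

Lemma innerBr x y z : inner x (y - z) = inner x y - inner x z.
Proof. by rewrite innerDr innerNr. Qed.

Lemma innerDl x y z : inner (x + y) z = inner x z + inner y z.
Proof. by rewrite inner_conj innerDr rmorphD /= -!inner_conj. Qed.

Lemma innerZl x a y : inner (a *: x) y = a^* * inner x y.
Proof. by rewrite inner_conj innerZr rmorphM /= -inner_conj. Qed.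

Lemma inner0l x : inner 0 x = 0.
Proof. by rewrite inner_conj inner0r rmorph0. Qed.

Lemma innerNl x y : inner (- x) y = - inner x y.
Proof. by rewrite -scaleN1r innerZl rmorphN1 mulN1r. Qed.

Lemma innerBl x y z : inner (x - y) z = inner x z - inner y z.
Proof. by rewrite innerDl innerNl. Qed.

Lemma inner_ge0 x : 0 <= inner x x.
Proof. by rewrite inner_norm exprn_ge0. Qed.

Lemma inner_eq0 x : inner x x = 0 -> x = 0.
Proof. by rewrite inner_norm => /eqP; rewrite sqrf_eq0 normr_eq0 => /eqP. Qed.

Lemma inner_lt x e : 0 < e -> (inner x x < e ^+ 2) = (`|x| < e).
Proof. by move=> e0; rewrite inner_norm ltr_sqr ?nnegrE// ltW. Qed.

Lemma inner_proj x y : inner y y != 0 ->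
  let u := x - (inner y x / inner y y) *: y in
  inner u u = inner x x - `|inner y x| ^+ 2 / inner y y.
Proof.
move=> y0 /=; set a := _ / _.
have yu : inner y (x - a *: y) = 0 by rewrite innerBr innerZr divfK ?subrr.
rewrite {1}innerBl innerZl yu mulr0 subr0 innerBr innerZr; congr (_ - _).
by rewrite normCK -(inner_conj y x) mulrAC.
Qed.

Lemma CauchySchwarz x y : `|inner x y| <= `|x| * `|y|.
Proof.
rewrite -ler_sqr ?nnegrE ?mulr_ge0// exprMn -!inner_norm.
have [x0|xn0] := eqVneq (inner x x) 0.
  by rewrite (inner_eq0 x0) !inner0l normr0 expr0n mul0r.
have x0 : 0 < inner x x by rewrite lt_def xn0 inner_ge0.
have := inner_ge0 (y - (inner x y / inner x x) *: x).
by rewrite inner_proj// subr_ge0 ler_pdivrMr// mulrC.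
Qed.

Lemma parallelogram x y :
  inner (x - y) (x - y) + inner (x + y) (x + y) = (inner x x + inner y y) *+ 2.
Proof.
by rewrite innerBl !innerBr innerDl !innerDr; ring.
Qed.

Lemma inner_complete (F : set_system H) : ProperFilter F ->
  (forall e, 0 < e -> exists x, F [set y | inner (x - y) (x - y) < e]) ->
  exists l, forall e, 0 < e -> F [set y | inner (l - y) (l - y) < e].
Proof.
move=> FF Fc; have /cauchy_cvg/cvg_ex[l /cvgrPdist_lt Fl] : cauchy F.
  apply/cauchyP => e e0; have [x Fx] := Fc _ (exprn_gt0 2 e0).
  by exists x; apply: filterS Fx => y; rewrite -ball_normE /= inner_lt.
exists l => e e0; have s0 : 0 < sqrtC e by rewrite sqrtC_gt0.
by apply: filterS (Fl _ s0) => y /=; rewrite -inner_lt// sqrtCK.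
Qed.

Lemma closed_adherentP (A : set H) :
  closed A <-> forall x, (forall e, 0 < e -> exists2 y, A y & `|x - y| < e) -> A x.
Proof.
split=> [cA x Ax|AA x clx].
  apply: cA => B /nbhs_ballP[e /= e0 eB].
  have [y Ay xy] := Ax _ e0; exists y; split => //; apply: eB.
  by rewrite -ball_normE.
apply: AA => e e0; have [y [Ay]] := clx _ (nbhsx_ballx x e e0).
by rewrite -ball_normE; exists y.
Qed.

Lemma dense_adherentP (A : set H) :
  dense A <-> forall x e, 0 < e -> exists2 y, A y & `|x - y| < e.
Proof.
split=> [dA x e e0|dA U [x Ux] oU].
  have [||y [yx Ay]] := dA (ball x e); last by move: yx; rewrite -ball_normE; exists y.
    by exists x; exact: ballxx.
  exact: ball_open.
have /nbhs_ballP[e /= e0 eU] : nbhs x U by exact: open_nbhs_nbhs.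
have [y Ay xy] := dA x e e0; exists y; split => //; apply: eU.
by rewrite -ball_normE.
Qed.

Lemma norm_small_eq0 (V : normedModType R[i]) (v : V) (M : R[i]) : 0 <= M ->
  (forall e, 0 < e -> `|v| <= M * e) -> v = 0.
Proof.
move=> M0 vM; apply/eqP; apply: contraT => v_neq0.
have v0 : 0 < `|v| by rewrite normr_gt0.
have M1 : 0 < M + 1 by rewrite ltr_wpDl ?ltr01.
have e0 : 0 < `|v| / (M + 1) by rewrite divr_gt0.
have := vM _ e0; rewrite mulrA ler_pdivlMr// mulrC ler_pM2r//.
by rewrite -subr_ge0 opprD addNKr oppr_ge0 ler10.
Qed.

End InnerTheory.

(* The Hilbert direct sum; the library norm on pairs is the max norm, hence the
   alias. *)
Definition hsum (R : realType) (H K : hilbertType R) : Type := (H * K)%type.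

Section DirectSum.
Variables (R : realType) (H K : hilbertType R).

HB.instance Definition _ := GRing.Lmodule.copy (hsum H K) (H * K)%type.

Let ip (x y : hsum H K) : R[i] := inner x.1 y.1 + inner x.2 y.2.

Let ipP x a y z : ip x (a *: y + z) = a * ip x y + ip x z.
Proof. by rewrite /ip !innerP mulrDr addrACA. Qed.

Let ip_conj x y : ip y x = (ip x y)^*.
Proof. by rewrite /ip rmorphD /= -!inner_conj. Qed.

Let ip_ge0 x : 0 <= ip x x. Proof. by rewrite addr_ge0 ?inner_ge0. Qed.

Let ip_eq0 x : ip x x = 0 -> x = 0.
Proof.
move=> /eqP; rewrite paddr_eq0 ?inner_ge0// => /andP[/eqP x1 /eqP x2].
by rewrite [x]surjective_pairing (inner_eq0 x1) (inner_eq0 x2).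
Qed.

Let ip_complete (F : set_system (hsum H K)) : ProperFilter F ->
  (forall e, 0 < e -> exists x, F [set y | ip (x - y) (x - y) < e]) ->
  exists l, forall e, 0 < e -> F [set y | ip (l - y) (l - y) < e].
Proof.
move=> FF Fc.
have [e e0|l1 Fl1] := @inner_complete R H (fmap (fun x : hsum H K => x.1) F) _.
  have [x Fx] := Fc e e0; exists x.1; apply: (@filterS _ F _ _ _ _ Fx) => y /=.
  by apply: le_lt_trans; rewrite /ip lerDl inner_ge0.
have [e e0|l2 Fl2] := @inner_complete R K (fmap (fun x : hsum H K => x.2) F) _.
  have [x Fx] := Fc e e0; exists x.2; apply: (@filterS _ F _ _ _ _ Fx) => y /=.
  by apply: le_lt_trans; rewrite /ip lerDr inner_ge0.
exists (l1, l2) => e e0; have e20 : 0 < e / 2 by rewrite divr_gt0.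
apply: (@filterS2 _ F _ _ _ _ _ (Fl1 _ e20) (Fl2 _ e20)) => y /= y1 y2.
by rewrite [e]splitr ltrD.
Qed.

HB.instance Definition _ :=
  Lmodule_isHilbert.Build R (hsum H K) ipP ip_conj ip_ge0 ip_eq0 ip_complete.

Lemma inner_hsum (x y : hsum H K) : inner x y = inner x.1 y.1 + inner x.2 y.2.
Proof. by []. Qed.

Lemma hsum_norm1 (x : hsum H K) : `|x.1| <= `|x|.
Proof. by rewrite -ler_sqr ?nnegrE// -!inner_norm inner_hsum lerDl inner_ge0. Qed.

Lemma hsum_norm2 (x : hsum H K) : `|x.2| <= `|x|.
Proof. by rewrite -ler_sqr ?nnegrE// -!inner_norm inner_hsum lerDr inner_ge0. Qed.

Lemma hsum_norm (x : hsum H K) : `|x| <= `|x.1| + `|x.2|.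
Proof.
rewrite -ler_sqr ?nnegrE ?addr_ge0// -inner_norm inner_hsum !inner_norm sqrrD.
by rewrite lerD2r lerDl mulrn_wge0 ?mulr_ge0.
Qed.

End DirectSum.

(* The inner product pulled back along an injective linear map with closed range. *)
Section Pullback.
Variables (R : realType) (V : lmodType R[i]) (H : hilbertType R).
Variable J : {linear V -> H}.
Hypothesis J_inj : forall v, J v = 0 -> v = 0.
Hypothesis J_closed : closed (range J).

Definition pullback_ip (x y : V) : R[i] := inner (J x) (J y).

Lemma pullback_ipP x a y z :
  pullback_ip x (a *: y + z) = a * pullback_ip x y + pullback_ip x z.
Proof. by rewrite /pullback_ip linearP innerP. Qed.

Lemma pullback_ip_conj x y : pullback_ip y x = (pullback_ip x y)^*.
Proof. exact: inner_conj. Qed.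

Lemma pullback_ip_ge0 x : 0 <= pullback_ip x x.
Proof. exact: inner_ge0. Qed.

Lemma pullback_ip_eq0 x : pullback_ip x x = 0 -> x = 0.
Proof. by move=> /inner_eq0 /J_inj. Qed.

Lemma pullback_ip_complete (F : set_system V) : ProperFilter F ->
  (forall e, 0 < e -> exists x, F [set y | pullback_ip (x - y) (x - y) < e]) ->
  exists l, forall e, 0 < e -> F [set y | pullback_ip (l - y) (l - y) < e].
Proof.
move=> FF Fc.
have [e e0|l Fl] := @inner_complete R H (fmap J F) _.
  have [x Fx] := Fc e e0; exists (J x); apply: (@filterS _ F _ _ _ _ Fx) => y /=.
  by rewrite /pullback_ip linearB.
have [v _ vl] : range J l.
  move/closed_adherentP : J_closed; apply => e e0.
  have /(@filter_ex _ F _)[y /= yl] := Fl _ (exprn_gt0 2 e0).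
  by exists (J y); [exists y|rewrite -inner_lt].
exists v => e e0; apply: (@filterS _ F _ _ _ _ (Fl _ e0)) => y /=.
by rewrite /pullback_ip linearB vl.
Qed.

End Pullback.

Record subspace (K : nzRingType) (V : lmodType K) := Subspace {
  carrier :> set V;
  subspace0 : carrier 0;
  subspaceP : forall (a : K) (x y : V),
    carrier x -> carrier y -> carrier (a *: x + y)
}.

Section SubspaceType.
Variables (K : nzRingType) (V : lmodType K) (W : subspace V).

Definition subspace_pred : {pred V} := fun x => `[< carrier W x >].

Lemma subspace_predP : submod_closed subspace_pred.
Proof.
split; first by apply/asboolP; exact: subspace0.
by move=> a x y /asboolP Wx /asboolP Wy; apply/asboolP; exact: subspaceP.
Qed.

HB.instance Definition _ :=
  GRing.isSubmodClosed.Build K V subspace_pred subspace_predP.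

Definition subspace_type : Type := {x : V | x \in subspace_pred}.

HB.instance Definition _ := SubChoice.on subspace_type.
HB.instance Definition _ := [SubChoice_isSubLmodule of subspace_type by <:].

Definition in_subspace (x : V) (Wx : carrier W x) : subspace_type :=
  exist _ x (asboolT Wx).

Lemma val_in_subspace x (Wx : carrier W x) : \val (in_subspace Wx) = x. Proof. by []. Qed.

Lemma subspace_valP (x : subspace_type) : carrier W (\val x).
Proof. by apply/asboolP; exact: (valP x). Qed.

End SubspaceType.

Section Projection.
Variables (R : realType) (H : hilbertType R) (N : subspace H).
Hypothesis N_closed : closed N.

Let q (x : H) : R := complex.Re (inner x x).

Let qE x : (q x)%:C%C = inner x x.
Proof. by rewrite /q RRe_real// ger0_real// inner_ge0. Qed.

Let ltq x (e : R) : (q x < e) = (inner x x < e%:C%C).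
Proof. by rewrite -qE ltcR. Qed.

Let q_ge0 x : 0 <= q x.
Proof. by rewrite -lecR qE inner_ge0. Qed.

Lemma orthogonal_projection_exists (x : H) :
  exists y, carrier N y /\ forall z, carrier N z -> inner z (x - y) = 0.
Proof.
pose S := [set q (x - n) | n in N].
have S0 : has_inf S.
  split; first by exists (q (x - 0)); exists 0; [exact: subspace0|].
  by exists 0 => _ [n _ <-]; exact: q_ge0.
pose m := inf S.
have mq n : carrier N n -> m <= q (x - n).
  by move=> Nn; apply: ge_inf; [exact: S0.2|exists n].
pose A (e : R) := [set n | carrier N n /\ q (x - n) < m + e].
have A0 e : 0 < e -> A e !=set0.
  by move=> e0; have [_ [n Nn <-] ?] := inf_adherent e0 S0; exists n.
pose F := filter_from [set e : R | 0 < e] A.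
have FF : ProperFilter F.
  apply: filter_from_proper => //.
  apply: filter_from_filter; first by exists 1; rewrite /= ltr01.
  move=> e1 e2 e10 e20; exists (Num.min e1 e2); first by rewrite /= lt_min e10.
  move=> n [Nn qn]; split; split=> //; apply: lt_le_trans qn _;
    by rewrite lerD2l ge_min lexx ?orbT.
have N2 a u v : carrier N u -> carrier N v -> carrier N (a *: u + v) by exact: subspaceP.
have FA e : 0 < e -> F (A e) by exists e.
have qpar u v : q (u - v) + q (u + v) = (q u + q v) *+ 2.
  by apply: complexI; rewrite !(rmorphD, rmorphMn)/= !qE parallelogram.
have qhalf u : q u = q (2^-1 *: u) *+ 4.
  apply: complexI; rewrite rmorphMn/= !qE innerZl innerZr.
  by rewrite fmorphV; field.
have qc n n' r : A r n -> A r n' -> q (n - n') < r *+ 4.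
  move=> [Nn qn] [Nn' qn'].
  have dE : x - n' - (x - n) = n - n' by rewrite opprB [LHS]addrC addrA subrK.
  have := qpar (x - n') (x - n); rewrite dE => qE1.
  have := mq _ (N2 2^-1 _ _ (N2 1 _ _ Nn Nn') (subspace0 N)).
  have -> : x - (2^-1 *: (1 *: n + n') + 0) = 2^-1 *: ((x - n') + (x - n)).
    have -> : x - n' + (x - n) = 2 *: x - (n + n').
      by rewrite addrACA [- n' - n]addrC -opprD scaler_nat mulr2n.
    by rewrite addr0 scale1r scalerBr scalerA mulVf ?pnatr_eq0// scale1r.
  have := qhalf ((x - n') + (x - n)); lra.
have eC (e : R[i]) : 0 < e -> exists2 r : R, 0 < r & e = r%:C%C.
  by move=> e0; exists (complex.Re e); rewrite -?ltcR RRe_real ?gtr0_real.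
have [_ /eC[r r0 ->]|l Fl] := @inner_complete R H F FF.
  have r40 : 0 < r / 4 by rewrite divr_gt0.
  have [n0 An0] := A0 _ r40; exists n0; exists (r / 4) => // n An.
  by rewrite /= -ltq; have := qc _ _ _ An0 An; lra.
have Al (e : R[i]) r : 0 < e -> 0 < r -> exists2 n, A r n & `|l - n| < e.
  move=> e0 r0; have FI : F ([set y | inner (l - y) (l - y) < e ^+ 2] `&` A r).
    by apply: filterI; [exact: Fl (exprn_gt0 2 e0)|exact: FA].
  have /filter_ex[n [/= nl An]] := FI.
  by exists n => //; rewrite -inner_lt.
exists l; split.
  move/closed_adherentP : N_closed; apply => e e0.
  by have [n [Nn _] nl] := Al e 1 e0 ltr01; exists n.
move=> z Nz; have [zz|zz] := eqVneq (inner z z) 0.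
  by rewrite (inner_eq0 zz) inner0l.
have z0 : 0 < inner z z by rewrite lt_def zz inner_ge0.
apply: (@norm_small_eq0 R R[i]^o _ (`|z| *+ 2)) => [|_ /eC[r r0 ->]].
  by rewrite mulrn_wge0.
have [n [Nn qn] nl] := Al r%:C%C (r ^+ 2) (etrans (ltcR _ _) r0) (exprn_gt0 2 r0).
have -> : x - l = (x - n) - (l - n) by rewrite opprB addrA subrK.
rewrite innerBr mulrnAl mulr2n; apply: (le_trans (ler_normB _ _)).
apply: lerD; last first.
  by apply: (le_trans (CauchySchwarz _ _)); rewrite ler_wpM2l// ltW.
have rC0 : 0 <= r%:C%C by rewrite ler0c ltW.
rewrite -ler_sqr ?nnegrE ?mulr_ge0// exprMn -inner_norm mulrC.
rewrite -ler_pdivrMr//; set c := inner z (x - n).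
have := mq _ (N2 (c / inner z z) _ _ Nz Nn).
have -> : x - ((c / inner z z) *: z + n) = x - n - (c / inner z z) *: z.
  by rewrite opprD addrA addrAC.
rewrite -lecR qE inner_proj// lerBrDr -lerBrDl => /le_trans; apply.
by rewrite lerBlDl -rmorphXn -rmorphD -qE lecR ltW.
Qed.

End Projection.

(* The orthogonal projection of x onto N; it exists when N is closed. *)
Definition orthproj (R : realType) (H : hilbertType R) (N : subspace H) (x : H) : H :=
  xget 0 [set y | carrier N y /\ forall z, carrier N z -> inner z (x - y) = 0].

Lemma orthprojP (R : realType) (H : hilbertType R) (N : subspace H) (x : H) :
  closed (carrier N) -> carrier N (orthproj N x) /\
    forall z, carrier N z -> inner z (x - orthproj N x) = 0.
Proof.
move=> Ncl; have [y Ny] := orthogonal_projection_exists Ncl x.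
rewrite /orthproj; set S := [set _ | _]; suff: S (xget 0 S) by [].
by apply: xgetPex; exists y.
Qed.

Record linop (R : realType) (H K : hilbertType R) := Linop {
  domain : subspace H;
  linop_map :> {linear subspace_type domain -> K}
}.

Notation dom T := (subspace_type (domain T)).

Section Operators.
Variables (R : realType) (H K : hilbertType R).

Definition graph (T : linop H K) : set (hsum H K) :=
  range (fun f : dom T => (\val f, T f) : hsum H K).

Definition closed_operator (T : linop H K) : Prop := closed (graph T).

Definition densely_defined (T : linop H K) : Prop := dense (carrier (domain T)).

End Operators.

Section Restriction.
Variables (R : realType) (H K : hilbertType R) (T : linop H K) (W : subspace H).
Hypothesis WT : carrier W `<=` carrier (domain T).

Definition restr_map (f : subspace_type W) : K := T (in_subspace (WT (subspace_valP f))).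

Lemma restr_map_linear : linear restr_map.
Proof.
move=> a f g; rewrite /restr_map -linearP; congr (T _).
by apply: val_inj; rewrite [RHS]linearP !val_in_subspace linearP.
Qed.

HB.instance Definition _ := GRing.isLinear.Build R[i] (subspace_type W) K _
  restr_map restr_map_linear.

Definition restr : linop H K := Linop restr_map.

End Restriction.

Section Adjoint.
Variables (R : realType) (H K : hilbertType R) (T : linop H K).
Hypothesis T_dense : densely_defined T.

Definition adjoint_rel (g : K) (h : H) : Prop :=
  forall f : dom T, inner (T f) g = inner (\val f) h.

Definition adjoint_dom_set : set K := [set g | exists h, adjoint_rel g h].

Lemma adjoint_rel0 : adjoint_rel 0 0.
Proof. by move=> f; rewrite !inner0r. Qed.

Lemma adjoint_relP a g1 g2 h1 h2 : adjoint_rel g1 h1 -> adjoint_rel g2 h2 ->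
  adjoint_rel (a *: g1 + g2) (a *: h1 + h2).
Proof. by move=> gh1 gh2 f; rewrite !innerP gh1 gh2. Qed.

Lemma adjoint_dom0 : adjoint_dom_set 0.
Proof. by exists 0; exact: adjoint_rel0. Qed.

Lemma adjoint_domP (a : R[i]) (g1 g2 : K) :
  adjoint_dom_set g1 -> adjoint_dom_set g2 -> adjoint_dom_set (a *: g1 + g2).
Proof.
by move=> [h1 gh1] [h2 gh2]; exists (a *: h1 + h2); exact: adjoint_relP.
Qed.

Definition adjoint_dom : subspace K := Subspace adjoint_dom0 adjoint_domP.

Definition adjoint_map (g : subspace_type adjoint_dom) : H :=
  sval (cid (subspace_valP g)).

Lemma adjoint_mapP g : adjoint_rel (\val g) (adjoint_map g).
Proof. by rewrite /adjoint_map; case: cid. Qed.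

Lemma dense_orthogonal0 (A : set H) (h : H) :
  dense A -> (forall x, A x -> inner x h = 0) -> h = 0.
Proof.
move=> /dense_adherentP dA Ah; apply: inner_eq0.
apply: (@norm_small_eq0 R R[i]^o _ `|h|) => // e e0.
have [y Ay hy] := dA h e e0.
rewrite -[X in inner X h](subrK y) innerDl (Ah _ Ay) addr0.
by apply: (le_trans (CauchySchwarz _ _)); rewrite mulrC ler_wpM2l// ltW.
Qed.

Lemma adjoint_rel_uniq g h h' : adjoint_rel g h -> adjoint_rel g h' -> h = h'.
Proof.
move=> gh gh'; apply/eqP; rewrite -subr_eq0; apply/eqP.
apply: (dense_orthogonal0 T_dense) => x Tx.
have := gh (in_subspace Tx); rewrite gh' val_in_subspace => xhh'.
by rewrite innerBr xhh' subrr.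
Qed.

Lemma adjoint_map_linear : linear adjoint_map.
Proof.
move=> a g1 g2; apply: (adjoint_rel_uniq (adjoint_mapP _)).
by rewrite linearP; apply: adjoint_relP; exact: adjoint_mapP.
Qed.

HB.instance Definition _ := GRing.isLinear.Build R[i]
  (subspace_type adjoint_dom) H _ adjoint_map adjoint_map_linear.

Definition adjoint : linop K H := Linop adjoint_map.

Lemma graph_adjointP (x : hsum K H) : graph adjoint x <-> adjoint_rel x.1 x.2.
Proof.
split=> [[g _ <-]|gh]; first exact: adjoint_mapP.
have gdom : carrier (domain adjoint) x.1 by exists x.2.
exists (in_subspace gdom : dom adjoint) => //.
rewrite [RHS]surjective_pairing; congr pair.
exact: (adjoint_rel_uniq (adjoint_mapP _)).
Qed.

Lemma adjoint_closed : closed_operator adjoint.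
Proof.
apply/closed_adherentP => x Ax; apply/graph_adjointP => f.
apply/eqP; rewrite -subr_eq0; apply/eqP.
apply: (@norm_small_eq0 R R[i]^o _ (`|T f| + `|\val f|)) => [|e e0].
  by rewrite addr_ge0.
have [y /graph_adjointP yA xy] := Ax e e0.
have -> : inner (T f) x.1 - inner (\val f) x.2 =
  inner (T f) (x - y).1 - inner (\val f) (x - y).2.
  by rewrite /= !innerBr yA opprB addrA subrK.
rewrite mulrDl; apply: (le_trans (ler_normB _ _)); apply: lerD;
  apply: (le_trans (CauchySchwarz _ _)); rewrite ler_wpM2l//;
  apply: (le_trans _ (ltW xy)); [exact: hsum_norm1|exact: hsum_norm2].
Qed.

End Adjoint.

Record closed_linop (R : realType) (H K : hilbertType R) := ClosedLinop {
  closed_linop_op :> linop H K;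
  closed_linopP : closed_operator closed_linop_op
}.

(* The domain of a closed operator T, normed by |f|^2 + |T f|^2. *)
Definition graph_space (R : realType) (H K : hilbertType R) (T : closed_linop H K) :
  Type := dom T.

Section GraphSpace.
Variables (R : realType) (H K : hilbertType R) (T : closed_linop H K).

HB.instance Definition _ := GRing.Lmodule.copy (graph_space T) (dom T).

Definition gval (f : graph_space T) : H := \val (f : dom T).

Lemma gval_linear : linear gval. Proof. by move=> a f g; rewrite /gval linearP. Qed.

HB.instance Definition _ :=
  GRing.isLinear.Build R[i] (graph_space T) H _ gval gval_linear.

Definition graph_emb (f : graph_space T) : hsum H K := (gval f, T f).

Lemma graph_emb_linear : linear graph_emb.
Proof. by move=> a f g; rewrite /graph_emb !linearP. Qed.

HB.instance Definition _ :=
  GRing.isLinear.Build R[i] (graph_space T) (hsum H K) _ graph_emb graph_emb_linear.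

Lemma graph_emb_eq0 f : graph_emb f = 0 -> f = 0.
Proof. by move=> [f0 _]; apply: (@val_inj _ _ (dom T)). Qed.

HB.instance Definition _ := Lmodule_isHilbert.Build R (graph_space T)
  (@pullback_ipP R (graph_space T) (hsum H K) graph_emb)
  (@pullback_ip_conj R (graph_space T) (hsum H K) graph_emb)
  (@pullback_ip_ge0 R (graph_space T) (hsum H K) graph_emb)
  (@pullback_ip_eq0 R (graph_space T) (hsum H K) graph_emb graph_emb_eq0)
  (@pullback_ip_complete R (graph_space T) (hsum H K) graph_emb (@closed_linopP _ _ _ T)).

Lemma inner_graph_space (f g : graph_space T) :
  inner f g = inner (gval f) (gval g) + inner (T f) (T g).
Proof. by []. Qed.

Lemma graph_space_norm_gval (f : graph_space T) : `|gval f| <= `|f|.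
Proof.
by rewrite -ler_sqr ?nnegrE// -!inner_norm inner_graph_space lerDl inner_ge0.
Qed.

Lemma graph_space_norm_map (f : graph_space T) : `|T f| <= `|f|.
Proof.
by rewrite -ler_sqr ?nnegrE// -!inner_norm inner_graph_space lerDr inner_ge0.
Qed.

End GraphSpace.

Record ordinary_boundary_triple (R : realType) (H Gt : hilbertType R)
    (D : linop H H) (Gamma0 Gamma1 : dom D -> Gt) : Prop := OrdinaryBoundaryTriple {
  obt_closed : closed_operator D;
  obt_linear0 : linear Gamma0;
  obt_linear1 : linear Gamma1;
  obt_green : forall f g : dom D,
    inner (D f) (\val g) - inner (\val f) (D g) =
    inner (Gamma0 f) (Gamma1 g) - inner (Gamma1 f) (Gamma0 g);
  obt_surjective : forall phi psi : Gt,
    exists f : dom D, Gamma0 f = phi /\ Gamma1 f = psi;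
  obt_kernel_dense :
    dense [set \val f | f in [set f : dom D | Gamma0 f = 0 /\ Gamma1 f = 0]]
}.
Arguments ordinary_boundary_triple {R H Gt} D Gamma0 Gamma1.

Record first_order_boundary_triple (R : realType) (H0 H1 G : hilbertType R) :=
    FirstOrderBoundaryTriple {
  ext_d : closed_linop H0 H1;
  ext_d_dense : densely_defined ext_d;
  gamma0 : {linear graph_space ext_d -> G};
  gamma0_bounded : exists M : R, forall f, `|gamma0 f| <= M%:C%C * `|f|;
  gamma0_range_dense : dense (range gamma0);
  gamma0_ker_dense : dense [set gval f | f in [set f | gamma0 f = 0]]
}.

Section FirstOrder.
Variables (R : realType) (H0 H1 G : hilbertType R).
Variable T : first_order_boundary_triple H0 H1 G.

Local Notation d := (ext_d T).
Local Notation H01 := (graph_space d).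
Local Notation gam0 := (gamma0 T).

Definition ker_gamma0_set : set H0 := [set gval f | f in [set f | gam0 f = 0]].

Lemma ker_gamma0_0 : ker_gamma0_set 0.
Proof. by exists 0; [exact: linear0|]. Qed.

Lemma ker_gamma0_P (a : R[i]) (x y : H0) :
  ker_gamma0_set x -> ker_gamma0_set y -> ker_gamma0_set (a *: x + y).
Proof.
move=> [f /= f0 <-] [g /= g0 <-]; exists (a *: f + g); last exact: gval_linear.
by rewrite /= linearP f0 g0 scaler0 addr0.
Qed.

Definition ker_gamma0 : subspace H0 := Subspace ker_gamma0_0 ker_gamma0_P.

Lemma ker_gamma0_dom : carrier ker_gamma0 `<=` carrier (domain d).
Proof. by move=> _ [f _ <-]; exact: subspace_valP. Qed.

Definition d0 : linop H0 H1 := restr ker_gamma0_dom.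

Definition d0_dense : densely_defined d0 := gamma0_ker_dense T.

Definition delta : closed_linop H1 H0 :=
  ClosedLinop (adjoint_closed (T_dense := d0_dense)).

Local Notation H11 := (graph_space delta).

(* ker (delta d + 1) *)
Definition N0_set : set H01 :=
  [set f | exists g : H11, gval g = d f /\ delta g + gval f = 0].

(* ker (d delta + 1) *)
Definition N1_set : set H11 :=
  [set g | exists f : H01, gval f = delta g /\ d f + gval g = 0].

Lemma N0_0 : N0_set 0.
Proof. by exists 0; rewrite !linear0 addr0. Qed.

Lemma N0_P (a : R[i]) (x y : H01) : N0_set x -> N0_set y -> N0_set (a *: x + y).
Proof.
move=> [g [gx xg]] [h [hy yh]]; exists (a *: g + h); rewrite !linearP /= gx hy.
by split => //; rewrite addrACA -scalerDr xg yh scaler0 addr0.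
Qed.

Definition N0 : subspace H01 := Subspace N0_0 N0_P.

Lemma N1_0 : N1_set 0.
Proof. by exists 0; rewrite !linear0 addr0. Qed.

Lemma N1_P (a : R[i]) (x y : H11) : N1_set x -> N1_set y -> N1_set (a *: x + y).
Proof.
move=> [g [gx xg]] [h [hy yh]]; exists (a *: g + h); rewrite !linearP /= gx hy.
by split => //; rewrite addrACA -scalerDr xg yh scaler0 addr0.
Qed.

Definition N1 : subspace H11 := Subspace N1_0 N1_P.

Lemma deltaP (f : H01) (g : H11) : gam0 f = 0 ->
  inner (d f) (gval g) = inner (gval f) (delta g).
Proof.
move=> f0; have kf : carrier ker_gamma0 (gval f) by exists f.
have := adjoint_mapP (g : dom delta) (in_subspace kf : dom d0).
rewrite val_in_subspace => <-; congr (inner (d _) _).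
by apply: val_inj.
Qed.

Lemma graph_swap_closed (K L : hilbertType R) (A : closed_linop K L)
  (B : closed_linop L K)
  (N : set (graph_space A)) :
  (forall f, N f <-> graph B (A f, - gval f)) -> closed N.
Proof.
move=> NP; apply/closed_adherentP => f Nf; apply/NP.
move/closed_adherentP : (@closed_linopP _ _ _ B); apply => e e0.
have e20 : 0 < e / 2 by rewrite divr_gt0.
have [g /NP Ng fg] := Nf _ e20; exists (A g, - gval g) => //.
apply: (le_lt_trans (hsum_norm _)); rewrite /= -linearB opprK addrC -normrN opprD opprK.
rewrite -linearB [e]splitr; apply: ltrD.
  exact: le_lt_trans (graph_space_norm_gval _) fg.
exact: le_lt_trans (graph_space_norm_map _) fg.
Qed.

Lemma N0_closed : closed (carrier N0).
Proof.
apply: (@graph_swap_closed _ _ d delta) => f; split.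
  move=> [g [gE /eqP]]; rewrite addr_eq0 => /eqP dg.
  by exists g => //; rewrite -gE -dg.
move=> [g _ [gE dg]]; exists g; split=> //.
by apply/eqP; rewrite addr_eq0; apply/eqP.
Qed.

Lemma N1_closed : closed (carrier N1).
Proof.
apply: (@graph_swap_closed _ _ delta d) => f; split.
  move=> [g [gE /eqP]]; rewrite addr_eq0 => /eqP dg.
  by exists g => //; rewrite -gE -dg.
move=> [g _ [gE dg]]; exists g; split=> //.
by apply/eqP; rewrite addr_eq0; apply/eqP.
Qed.

Lemma gamma0_N0_inj f : carrier N0 f -> gam0 f = 0 -> f = 0.
Proof.
move=> [g [gE /eqP]]; rewrite addrC addr_eq0 => /eqP fE f0.
have dfE : inner (d f) (d f) = - inner (gval f) (gval f).
  by rewrite -{2}gE deltaP// -innerNr [X in inner _ (- X)]fE opprK.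
by apply: inner_eq0; rewrite inner_graph_space dfE subrr.
Qed.

Definition gker_set : set H01 := [set f | gam0 f = 0].

Lemma gker_0 : gker_set 0. Proof. exact: linear0. Qed.

Lemma gker_P (a : R[i]) (x y : H01) : gker_set x -> gker_set y -> gker_set (a *: x + y).
Proof. by rewrite /gker_set /= => x0 y0; rewrite linearP x0 y0 scaler0 addr0. Qed.

Definition gker : subspace H01 := Subspace gker_0 gker_P.

Lemma gker_closed : closed (carrier gker).
Proof.
apply/closed_adherentP => f kf; have [M gM] := gamma0_bounded T.
apply: (@norm_small_eq0 R G _ `|M%:C%C|) => // e e0; have [g g0 fg] := kf e e0.
rewrite -[gam0 f]subr0 -[X in _ - X]g0 -linearB; apply: (le_trans (gM _)).
apply: (@le_trans _ _ (`|M%:C%C| * `|f - g|)); last by rewrite ler_wpM2l// ltW.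
by rewrite ler_wpM2r// normc_def /= expr0n addr0 sqrtr_sqr lecR ler_norm.
Qed.

Lemma gker_orthogonal_N0 f :
  (forall z, gam0 z = 0 -> inner z f = 0) -> carrier N0 f.
Proof.
move=> fo; have rel : adjoint_rel d0 (d f) (- gval f).
  move=> z; have [w /= w0 wz] := subspace_valP z.
  have := fo w w0; rewrite inner_graph_space addrC innerNr => /eqP.
  rewrite addr_eq0 => /eqP wf; rewrite -[\val z]wz -wf; congr (inner (d _) _).
  by apply: val_inj; exact: esym.
have df : carrier (domain delta) (d f) by exists (- gval f).
exists (in_subspace df : H11); split=> //; apply/eqP; rewrite addr_eq0; apply/eqP.
exact: (adjoint_rel_uniq d0_dense (adjoint_mapP (in_subspace df : dom delta)) rel).
Qed.

Lemma gamma0_N0_surj phi : range gam0 phi -> exists2 f, carrier N0 f & gam0 f = phi.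
Proof.
move=> [f _ <-]; have [/= p0 po] := orthprojP f gker_closed.
exists (f - orthproj gker f); last by rewrite linearB /= p0 subr0.
exact: gker_orthogonal_N0.
Qed.

Lemma G12_0 : range gam0 0. Proof. by exists 0; rewrite ?linear0. Qed.

Lemma G12_P (a : R[i]) (x y : G) :
  range gam0 x -> range gam0 y -> range gam0 (a *: x + y).
Proof. by move=> [f _ <-] [g _ <-]; exists (a *: f + g); rewrite ?linearP. Qed.

Definition range_gamma0 : subspace G := Subspace G12_0 G12_P.

(* The range of gamma0 as a Hilbert space in its own right: its norm is carried
   over from N0 and is not the one induced by G. *)
Definition G12 : Type := subspace_type range_gamma0.

HB.instance Definition _ := GRing.Lmodule.copy G12 (subspace_type range_gamma0).

Definition G12_val (phi : G12) : G := \val (phi : subspace_type range_gamma0).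

Definition gamma0_hat_inv (phi : G12) : H01 :=
  sval (cid2 (gamma0_N0_surj (subspace_valP phi))).

Lemma gamma0_hat_inv_N0 phi : carrier N0 (gamma0_hat_inv phi).
Proof. by rewrite /gamma0_hat_inv; case: cid2. Qed.

Lemma gamma0_hat_invK phi : gam0 (gamma0_hat_inv phi) = G12_val phi.
Proof. by rewrite /gamma0_hat_inv; case: cid2. Qed.

Lemma gamma0_hat_inv_uniq phi f :
  carrier N0 f -> gam0 f = G12_val phi -> gamma0_hat_inv phi = f.
Proof.
move=> Nf fphi; apply/eqP; rewrite -subr_eq0; apply/eqP; apply: gamma0_N0_inj.
  rewrite addrC -scaleN1r; apply: N0_P => //; exact: gamma0_hat_inv_N0.
by rewrite linearB /= gamma0_hat_invK fphi subrr.
Qed.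

Lemma gamma0_hat_inv_linear : linear gamma0_hat_inv.
Proof.
move=> a phi psi; apply: gamma0_hat_inv_uniq.
  by apply: N0_P; exact: gamma0_hat_inv_N0.
by rewrite linearP /= !gamma0_hat_invK /G12_val linearP.
Qed.

HB.instance Definition _ :=
  GRing.isLinear.Build R[i] G12 H01 _ gamma0_hat_inv gamma0_hat_inv_linear.

Lemma gamma0_hat_inv_eq0 phi : gamma0_hat_inv phi = 0 -> phi = 0.
Proof.
move=> phi0; apply: (@val_inj _ _ (subspace_type range_gamma0)).
by rewrite -/(G12_val phi) -gamma0_hat_invK phi0 linear0.
Qed.

Lemma gamma0_hat_inv_closed : closed (range gamma0_hat_inv).
Proof.
have -> : range gamma0_hat_inv = carrier N0; last exact: N0_closed.
apply/seteqP; split=> [_ [phi _ <-]|f Nf]; first exact: gamma0_hat_inv_N0.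
have rf : carrier range_gamma0 (gam0 f) by exists f.
by exists (in_subspace rf : G12) => //; exact: gamma0_hat_inv_uniq.
Qed.

HB.instance Definition _ := Lmodule_isHilbert.Build R G12
  (@pullback_ipP R G12 H01 gamma0_hat_inv)
  (@pullback_ip_conj R G12 H01 gamma0_hat_inv)
  (@pullback_ip_ge0 R G12 H01 gamma0_hat_inv)
  (@pullback_ip_eq0 R G12 H01 gamma0_hat_inv gamma0_hat_inv_eq0)
  (@pullback_ip_complete R G12 H01 gamma0_hat_inv gamma0_hat_inv_closed).

Lemma G12_norm (phi : G12) : `|phi| = `|gamma0_hat_inv phi|.
Proof.
by apply: (@pexpIrn _ 2); rewrite ?nnegrE// -!inner_norm.
Qed.

(* N1 is a subspace of the graph space of delta, so orthogonality here refers to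
   the graph inner product. *)
Definition P1 (f : H11) : H11 := orthproj N1 f.

Lemma delta_P1_dom f : carrier (domain d) (delta (P1 f)).
Proof.
have [[h [<- _]] _] := orthprojP f N1_closed; exact: subspace_valP.
Qed.

Definition delta_P1 (f : H11) : H01 := in_subspace (delta_P1_dom f).

Definition gamma1 (f : H11) : G := - gam0 (delta_P1 f).

Lemma gamma0_range f : carrier range_gamma0 (gam0 f).
Proof. by exists f. Qed.

Lemma gamma1_range f : carrier range_gamma0 (gamma1 f).
Proof. by exists (- delta_P1 f); rewrite ?linearN. Qed.

Definition dirac_dom_set : set (hsum H0 H1) :=
  [set f | carrier (domain d) f.1 /\ carrier (domain delta) f.2].

Lemma dirac_dom0 : dirac_dom_set 0.
Proof. by split; exact: subspace0. Qed.

Lemma dirac_domP (a : R[i]) (x y : hsum H0 H1) :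
  dirac_dom_set x -> dirac_dom_set y -> dirac_dom_set (a *: x + y).
Proof. by move=> [x1 x2] [y1 y2]; split; exact: subspaceP. Qed.

Definition dirac_dom : subspace (hsum H0 H1) := Subspace dirac_dom0 dirac_domP.

Definition component0 (f : subspace_type dirac_dom) : H01 :=
  in_subspace (subspace_valP f).1.

Definition component1 (f : subspace_type dirac_dom) : H11 :=
  in_subspace (subspace_valP f).2.

Definition dirac_map (f : subspace_type dirac_dom) : hsum H0 H1 :=
  (delta (component1 f), d (component0 f)).

Lemma component0_linear : linear component0.
Proof.
by move=> a f g; apply: (@val_inj _ _ (dom d)); rewrite [RHS]gval_linear.
Qed.

Lemma component1_linear : linear component1.
Proof.
by move=> a f g; apply: (@val_inj _ _ (dom delta)); rewrite [RHS]gval_linear.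
Qed.

Lemma dirac_map_linear : linear dirac_map.
Proof.
by move=> a f g; rewrite /dirac_map component0_linear component1_linear !linearP.
Qed.

HB.instance Definition _ := GRing.isLinear.Build R[i] (subspace_type dirac_dom)
  (hsum H0 H1) _ dirac_map dirac_map_linear.

(* The matrix (0, delta; d, 0). *)
Definition dirac : linop (hsum H0 H1) (hsum H0 H1) := Linop dirac_map.

Definition Gamma0 (f : dom dirac) : G12 := in_subspace (gamma0_range (component0 f)).

Definition Gamma1 (f : dom dirac) : G12 := in_subspace (gamma1_range (component1 f)).

End FirstOrder.

Arguments dirac {R H0 H1 G} T.
Arguments Gamma0 {R H0 H1 G} T f.
Arguments Gamma1 {R H0 H1 G} T f.

(* Main.v *)
From mathcomp Require Import all_boot all_order all_algebra.
From mathcomp Require Import complex ring.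
From mathcomp Require Import all_classical all_reals topology normedtype.
Require Import Defs.

Set Implicit Arguments.
Unset Strict Implicit.
Unset Printing Implicit Defensive.

Import Order.TTheory GRing.Theory Num.Theory.
Import numFieldNormedType.Exports.

Local Open Scope classical_set_scope.
Local Open Scope ring_scope.

(** In the graph space of [d], [ker gamma0] and [N0] are orthogonal complements;
    and [d] and [delta] exchange [N0] and [N1], inverse to each other up to sign,
    since [delta (d n) = - n] on [N0] and [d (delta h) = - h] on [N1].

    Everything follows from one half of Green's identity ([half_green]):
    [<d f, g> - <f, delta g> = <gamma0 f, gamma1 g>], the right-hand side taken
    in the range of [gamma0].  Its left-hand side vanishes if [f] lies in
    [ker gamma0], by definition of [delta] as an adjoint, and also if [f] lies in
    [N0] and [g] is orthogonal to [N1], because then it is the graph inner product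
    of [d f] and [g].  So one may replace [f] by the element [n] of [N0] with the
    same trace and [g] by its projection [h] to [N1].  As [h = - d (delta h)], the
    left-hand side becomes minus the graph inner product of [n] and [delta h],
    and [- delta h] is the element of [N0] with trace [gamma1 g].

    Green's identity for the matrix operator is this identity for the pair
    [(f_0, g_1)] minus the conjugate of the one for [(g_0, f_1)].  The two
    boundary maps act on different components, so surjectivity may be checked on
    each; an element of [N0] and its image under [d] give preimages under
    [gamma0] and [gamma1].  For density of the kernels, that of [gamma0] is dense
    by assumption; that of [gamma1] contains the domain of the adjoint of [d] by
    [half_green], and the adjoint of a closed densely defined operator is densely
    defined ([adjoint_dense]). *)

(** * Orthogonal projections and dense subspaces *)

Section HilbertGeometry.
Variables (R : realType) (H : hilbertType R).
Implicit Types (W N : subspace H).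

Lemma orthproj_uniq N x y : closed (carrier N) -> carrier N y ->
  (forall z, carrier N z -> inner z (x - y) = 0) -> orthproj N x = y.
Proof.
move=> Ncl Ny yo; have [Np po] := orthprojP x Ncl.
apply/eqP; rewrite -subr_eq0; apply/eqP; apply: inner_eq0.
have Nd : carrier N (orthproj N x - y).
  by rewrite addrC -scaleN1r; exact: subspaceP.
have -> : inner (orthproj N x - y) (orthproj N x - y) =
  inner (orthproj N x - y) (x - y) - inner (orthproj N x - y) (x - orthproj N x).
  by rewrite -innerBr opprB [x - y + _]addrC addrA subrK.
by rewrite yo// po// subrr.
Qed.

Lemma orthproj_linear N : closed (carrier N) -> linear (orthproj N).
Proof.
move=> Ncl a x y; have [Nx xo] := orthprojP x Ncl; have [Ny yo] := orthprojP y Ncl.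
apply: orthproj_uniq => //; first exact: subspaceP.
by move=> z Nz; rewrite opprD addrACA -scalerBr innerP xo// yo// mulr0 addr0.
Qed.

(** The closure is spelled out through the norm so that it can be bundled as a
    subspace, onto which one can project. *)
Definition closure_set W : set H :=
  [set x | forall e, 0 < e -> exists2 y, carrier W y & `|x - y| < e].

Lemma closure_set0 W : closure_set W 0.
Proof. by move=> e e0; exists 0; [exact: subspace0|rewrite subrr normr0]. Qed.

Lemma closure_setP W (a : R[i]) x y :
  closure_set W x -> closure_set W y -> closure_set W (a *: x + y).
Proof.
move=> Wx Wy e e0; have e20 : 0 < e / 2 by rewrite divr_gt0.
(* Dividing by [`|a| + 1] instead of [`|a|] avoids a case split on [a = 0]. *)
have a10 : 0 < `|a| + 1 by rewrite ltr_wpDl.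
have [u Wu xu] := Wx _ (divr_gt0 e20 a10); have [v Wv yv] := Wy _ e20.
exists (a *: u + v); first exact: subspaceP.
rewrite opprD addrACA -scalerBr; apply: (le_lt_trans (ler_normD _ _)).
rewrite [e]splitr; apply: ler_ltD => //; rewrite normrZ.
move: xu; rewrite ltr_pdivlMr// => /ltW; apply: le_trans.
by rewrite mulrC ler_wpM2l// lerDl.
Qed.

Definition closure_subspace W : subspace H :=
  Subspace (closure_set0 W) (@closure_setP W).

Lemma closure_subspace_closed W : closed (carrier (closure_subspace W)).
Proof.
apply/closed_adherentP => x Wx e e0; have e20 : 0 < e / 2 by rewrite divr_gt0.
have [y Wy xy] := Wx _ e20; have [z Wz yz] := Wy _ e20; exists z => //.
rewrite -[x](subrK y) -addrA; apply: (le_lt_trans (ler_normD _ _)).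
by rewrite [e]splitr ltrD.
Qed.

(** The difference of [x] and its projection to the closure of [W] is orthogonal
    to [W], hence zero. *)
Lemma orthogonal0_dense W :
  (forall h, (forall x, carrier W x -> inner x h = 0) -> h = 0) -> dense (carrier W).
Proof.
move=> W0; apply/dense_adherentP => x.
have [cp po] := orthprojP x (@closure_subspace_closed W).
suff /eqP : x - orthproj (closure_subspace W) x = 0 by rewrite subr_eq0 => /eqP ->.
apply: W0 => z Wz; apply: po => e e0.
by exists z => //; rewrite subrr normr0.
Qed.

End HilbertGeometry.

Lemma hsum_dense (R : realType) (H K : hilbertType R) (A : set H) (B : set K) :
  dense A -> dense B -> dense [set x : hsum H K | A x.1 /\ B x.2].
Proof.
move=> /dense_adherentP dA /dense_adherentP dB; apply/dense_adherentP => x e e0.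
have e20 : 0 < e / 2 by rewrite divr_gt0.
have [y Ay xy] := dA x.1 _ e20; have [z Bz xz] := dB x.2 _ e20.
exists (y, z) => //; apply: (le_lt_trans (hsum_norm _)).
by rewrite [e]splitr ltrD.
Qed.

(** The four components are arranged as in the entries of a two-by-two operator
    matrix; the graph of an off-diagonal matrix splits into the graphs of its
    two entries along these pairs. *)
Lemma corners_norm (R : realType) (H K : hilbertType R)
    (x : hsum (hsum H K) (hsum H K)) :
  `|(x.1.1, x.2.2) : hsum H K| <= `|x| /\ `|(x.1.2, x.2.1) : hsum K H| <= `|x|.
Proof.
by split; rewrite -ler_sqr ?nnegrE// -!inner_norm !inner_hsum /=;
  apply: lerD; rewrite ?lerDl ?lerDr inner_ge0.
Qed.

(** * Closed operators and their adjoints *)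

Section GraphSpaceTheory.
Variables (R : realType) (H K : hilbertType R) (A : closed_linop H K).
Implicit Types f g : graph_space A.

Lemma gvalB f g : gval (f - g) = gval f - gval g.
Proof. exact: linearB. Qed.

Lemma gvalN f : gval (- f) = - gval f.
Proof. exact: linearN. Qed.

Lemma closed_linopB f g : A (f - g) = A f - A g.
Proof. exact: linearB. Qed.

End GraphSpaceTheory.

Section Adjoint.
Variables (R : realType) (H K : hilbertType R) (T : closed_linop H K).

Lemma graph0 : graph T 0.
Proof. by exists 0 => //; rewrite !linear0. Qed.

Lemma graphP (a : R[i]) (x y : hsum H K) :
  graph T x -> graph T y -> graph T (a *: x + y).
Proof.
by move=> [f _ <-] [g _ <-]; exists (a *: f + g) => //; rewrite !linearP.
Qed.

Definition graph_subspace : subspace (hsum H K) := Subspace graph0 graphP.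

(** If [x] is orthogonal to the domain of the adjoint, split
    [(0, x) = (f, T f) + (u, v)] with [(u, v)] orthogonal to the graph of [T].
    Then [v] lies in the domain of the adjoint, with value [- u = f], so that
    [0 = <v, x> = <v, v> + <v, T f> = <v, v> + <f, f>]; hence [v] and [f] vanish,
    and so does [x]. *)
Lemma adjoint_dense (T_dense : densely_defined T) :
  densely_defined (adjoint T_dense).
Proof.
apply: orthogonal0_dense => x xo.
have [[f _ fE] po] := @orthprojP _ _ graph_subspace ((0, x) : hsum H K) (@closed_linopP _ _ _ T).
rewrite -fE in po.
have vu : adjoint_rel T (x - T f) (\val f).
  move=> g; have /po : graph T ((\val g, T g) : hsum H K) by exists g.
  rewrite inner_hsum /= sub0r innerNr addrC => /eqP.
  by rewrite subr_eq0 => /eqP.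
have := xo _ (ex_intro _ _ vu : carrier (domain (adjoint T_dense)) (x - T f)).
rewrite -{2}[x](subrK (T f)) innerDr [inner _ (T f)]inner_conj vu -inner_conj => /eqP.
rewrite paddr_eq0 ?inner_ge0// => /andP[/eqP/inner_eq0 xf /eqP/inner_eq0 f0].
have {}f0 : f = 0 by apply: val_inj.
by move: xf; rewrite f0 linear0 subr0.
Qed.

End Adjoint.

(** * The boundary triple *)

Section FirstOrder.
Variables (R : realType) (H0 H1 G : hilbertType R).
Variable T : first_order_boundary_triple H0 H1 G.

Local Notation d := (ext_d T).
Local Notation delta := (delta T).
Local Notation H01 := (graph_space d).
Local Notation H11 := (graph_space delta).
Local Notation G12 := (G12 T).
Local Notation ext := (@gamma0_hat_inv R H0 H1 G T).

(** [Gamma0] and [Gamma1] as maps on the graph spaces of [d] and [delta]: each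
    sees only one component of its argument, so their properties can be studied
    on the two components separately. *)
Definition trace0 (f : H01) : G12 := in_subspace (gamma0_range f).
Definition trace1 (g : H11) : G12 := in_subspace (gamma1_range g).

Lemma Gamma0E f : Gamma0 T f = trace0 (component0 f). Proof. by []. Qed.

Lemma Gamma1E f : Gamma1 T f = trace1 (component1 f). Proof. by []. Qed.

Lemma trace0_linear : linear trace0.
Proof.
move=> a f g; apply: (@val_inj _ _ (subspace_type (range_gamma0 T))).
by rewrite [RHS]linearP /= linearP.
Qed.

Lemma delta_P1_linear : linear (@delta_P1 R H0 H1 G T).
Proof.
move=> a f g; apply: (@val_inj _ _ (dom d)); rewrite [RHS]gval_linear.
change (delta (P1 (a *: f + g)) = a *: delta (P1 f) + delta (P1 g)).
by rewrite /P1 (orthproj_linear (@N1_closed _ _ _ _ T)) (linearP delta).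
Qed.

Lemma trace1_linear : linear trace1.
Proof.
move=> a f g; apply: (@val_inj _ _ (subspace_type (range_gamma0 T))).
rewrite [RHS]linearP /= /gamma1 delta_P1_linear linearP /=.
by rewrite opprD scalerN.
Qed.

(** Applying [d] to [delta (d n) = - n] gives the equation defining [N1] at [d n]. *)
Lemma d_N0_N1 (n : H01) : carrier (N0 T) n ->
  exists g : H11, [/\ carrier (N1 T) g, gval g = d n & delta g = - gval n].
Proof.
move=> [g [gE /eqP]]; rewrite addr_eq0 => /eqP dg.
exists g; split=> //; exists (- n); rewrite !linearN /= dg.
by rewrite gE addNr.
Qed.

Lemma P1_N1 (g : H11) : carrier (N1 T) (P1 g).
Proof. by have [] := orthprojP g (@N1_closed _ _ _ _ T). Qed.

Lemma d_delta_P1 (g : H11) : d (delta_P1 g) = - gval (P1 g).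
Proof.
have [f [fE /eqP]] := P1_N1 g; rewrite addr_eq0 => /eqP <-.
by congr (d _); apply: (@val_inj _ _ (dom d)); rewrite /= -fE.
Qed.

Lemma delta_P1_N0 (g : H11) : carrier (N0 T) (delta_P1 g).
Proof.
exists (- P1 g); rewrite !linearN /= d_delta_P1; split=> //.
exact: addNr.
Qed.

(** Identifies the boundary value [gamma1 g] through its representative in [N0],
    which is what the inner product of [G12] is computed with. *)
Lemma ext_trace1 (g : H11) : ext (trace1 g) = - delta_P1 g.
Proof.
apply: gamma0_hat_inv_uniq; last by rewrite linearN.
rewrite -scaleN1r -[X in carrier _ X]addr0; apply: N0_P; last exact: N0_0.
exact: delta_P1_N0.
Qed.

Lemma ext_trace0_ker (f : H01) : gamma0 T (f - ext (trace0 f)) = 0.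
Proof. by rewrite linearB /= gamma0_hat_invK subrr. Qed.

(** Both sides depend only on the components of [f] in [N0] and of [g] in [N1],
    where [d] and [delta] act as inverse to each other up to sign. *)
Lemma half_green (f : H01) (g : H11) :
  inner (d f) (gval g) - inner (gval f) (delta g) = inner (trace0 f) (trace1 g).
Proof.
set n := ext (trace0 f).
(* [f - n] lies in [ker gamma0], on which [delta] is adjoint to [d]. *)
have red : inner (d f) (gval g) - inner (gval f) (delta g) =
    inner (d n) (gval g) - inner (gval n) (delta g).
  have := deltaP g (ext_trace0_ker f); rewrite gvalB closed_linopB !innerBl -/n => /eqP.
  by rewrite subr_eq => /eqP ->; ring.
(* [m] is [d n] as an element of [N1]; pairing it in the graph inner product with
   [g - P1 g], which is orthogonal to [N1], replaces [g] by [P1 g]. *)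
have [m [Nm mE dm]] := d_N0_N1 (gamma0_hat_inv_N0 (trace0 f) : carrier (N0 T) n).
have [_ po] := orthprojP g (@N1_closed _ _ _ _ T).
have := po m Nm; rewrite -/(P1 g) inner_graph_space mE dm innerNl.
rewrite gvalB closed_linopB !innerBr => po'.
have -> : inner (trace0 f) (trace1 g) = inner n (ext (trace1 g)) by [].
rewrite red ext_trace1 innerNr inner_graph_space d_delta_P1 innerNr.
apply/eqP; rewrite -subr_eq0 -po'.
by have -> : gval (delta_P1 g) = delta (P1 g) by []; apply/eqP; ring.
Qed.

Lemma trace0_ext (phi : G12) : trace0 (ext phi) = phi.
Proof.
apply: (@val_inj _ _ (subspace_type (range_gamma0 T))).
by rewrite /= gamma0_hat_invK.
Qed.

(** With [n] in [N0] representing [psi], take [g = d n]: it lies in [N1], so it is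
    its own projection, and [- delta g = n]. *)
Lemma trace1_surj (psi : G12) : exists g : H11, trace1 g = psi.
Proof.
have [g [Ng _ dg]] := d_N0_N1 (gamma0_hat_inv_N0 psi).
exists g; rewrite -[RHS]trace0_ext -[LHS]trace0_ext ext_trace1.
have P1g : P1 g = g.
  apply: orthproj_uniq => //; first exact: N1_closed.
  by move=> z _; rewrite subrr inner0r.
congr trace0; apply: (@val_inj _ _ (dom d)); rewrite [LHS]gvalN.
by rewrite -[gval (delta_P1 g)]/(delta (P1 g)) P1g dg opprK.
Qed.

(** Every [w] in the domain of the adjoint of [d] has trace zero: it lies in the
    domain of [delta], the adjoint of a restriction of [d], with the same value, so
    [half_green] makes its trace orthogonal to every [trace0 f]; take [f] with
    [trace0 f = trace1 w]. *)
Lemma ker_trace1_dense : dense [set gval g | g in [set g | trace1 g = 0]].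
Proof.
have /dense_adherentP dd := adjoint_dense (ext_d_dense T).
apply/dense_adherentP => x e e0; have [w [u wu] xw] := dd x e e0.
have du : adjoint_rel (d0 T) w u by move=> z; exact: wu.
pose g : H11 := in_subspace (ex_intro _ u du : carrier (domain delta) w).
exists w => //; exists g => //=; apply: inner_eq0.
rewrite -{1}[trace1 g]trace0_ext -half_green.
have -> : delta g = u.
  exact: (adjoint_rel_uniq (d0_dense T) (adjoint_mapP (g : dom delta)) du).
by rewrite [X in X - _]wu subrr.
Qed.

(** Up to the order of the components, the graph of the matrix operator is the
    sum of the graphs of [d] and [delta]. *)
Lemma dirac_closed : closed_operator (dirac T).
Proof.
apply/closed_adherentP => x Dx.
have Gd : graph d (x.1.1, x.2.2).
  move/closed_adherentP : (@closed_linopP _ _ _ d); apply=> e e0.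
  have [_ [f _ <-] xf] := Dx _ e0.
  exists (gval (component0 f), d (component0 f)); first by exists (component0 f).
  exact: le_lt_trans (corners_norm (x - (\val f, dirac T f) : hsum _ _)).1 xf.
have Gdelta : graph delta (x.1.2, x.2.1).
  move/closed_adherentP : (@closed_linopP _ _ _ delta); apply=> e e0.
  have [_ [f _ <-] xf] := Dx _ e0.
  exists (gval (component1 f), delta (component1 f)); first by exists (component1 f).
  exact: le_lt_trans (corners_norm (x - (\val f, dirac T f) : hsum _ _)).2 xf.
have [f0 _ [f01 f02]] := Gd; have [f1 _ [f11 f12]] := Gdelta.
have Df : carrier (dirac_dom T) x.1.
  by split; [rewrite -f01|rewrite -f11]; exact: subspace_valP.
exists (in_subspace Df : dom (dirac T)) => //.
have c0 : component0 (in_subspace Df) = f0 by apply: val_inj; rewrite /= f01.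
have c1 : component1 (in_subspace Df) = f1 by apply: val_inj; rewrite /= f11.
rewrite [RHS]surjective_pairing; congr pair.
by rewrite /= /dirac_map c0 c1 [RHS]surjective_pairing -f02 -f12.
Qed.

End FirstOrder.

Theorem lemma3p2 (R : realType) (H0 H1 G : hilbertType R)
    (T : first_order_boundary_triple H0 H1 G) :
  ordinary_boundary_triple (dirac T) (Gamma0 T) (Gamma1 T).
Proof.
split.
- exact: dirac_closed.
- move=> a f g; rewrite Gamma0E (component0_linear a f g).
  exact: trace0_linear.
- move=> a f g; rewrite Gamma1E (component1_linear a f g).
  exact: trace1_linear.
(* Green's identity: [half_green] for [(f_0, g_1)], and conjugated for [(g_0, f_1)]. *)
- move=> f g; rewrite !Gamma0E !Gamma1E -half_green.
  rewrite [inner (trace1 _) _]inner_conj -half_green rmorphB /= -!inner_conj.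
  have regroup (a b c e : R[i]) : e + a - (b + c) = a - b - (c - e) by ring.
  exact: regroup.
- move=> phi psi; have [g gpsi] := trace1_surj psi.
  pose f := gamma0_hat_inv phi.
  have Df : carrier (dirac_dom T) (gval f, gval g).
    by split; exact: subspace_valP.
  exists (in_subspace Df); rewrite -gpsi -[RHS in _ = RHS /\ _](trace0_ext phi); split.
    by congr trace0; apply: val_inj.
  by congr trace1; apply: val_inj.
- have /dense_adherentP dk := hsum_dense (gamma0_ker_dense T) (@ker_trace1_dense _ _ _ _ T).
  apply/dense_adherentP => x e e0; have [y [[f f0 fy] [g g0 gy]] xy] := dk x e e0.
  exists y => //.
  have Df : carrier (dirac_dom T) y.
    by split; [rewrite -fy|rewrite -gy]; exact: subspace_valP.
  exists (in_subspace Df) => //; split.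
    apply: (@val_inj _ _ (subspace_type (range_gamma0 T))).
    by rewrite -[RHS]f0 /=; congr (gamma0 T _); apply: val_inj; rewrite /= -fy.
  by rewrite -[RHS]g0; congr trace1; apply: val_inj; rewrite /= -gy.
Qed.
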